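(* For every pair of integers $m\geq k\geq 3$ and for every integer $n$ with $n\geq \max\{4, m\}$, there exist real $n\times n$ symmetric matrices $A, B$ with $\min\{\operatorname{rank}(A),\operatorname{rank}(B)\}=k$ and $\max\{\operatorname{rank}(A),\operatorname{rank}(B)\}= m$ for which the weak interlacing property fails.
   Context: All matrices are real and $\otimes$ is the Kronecker product. Let $T\in\mathbb{R}^{n^2\times n^2}$ be the commutation matrix, i.e. $T\operatorname{vec}(X)=\operatorname{vec}(X^\top)$ for all $X\in\mathbb{R}^{n\times n}$, where $\operatorname{vec}$ stacks columns. The weak interlacing property holds for symmetric $n\times n$ matrices $A,B$ if both $$\min_{Tu=u}\frac{u^\top(A\otimes B)u}{u^\top u}\le\min_{Tw=-w}\frac{w^\top(A\otimes B)w}{w^\top w}\quad\text{and}\quad\max_{Tw=-w}\frac{w^\top(A\otimes B)w}{w^\top w}\le\max_{Tu=u}\frac{u^\top(A\otimes B)u}{u^\top u}$$ hold, the optimizations being over nonzero vectors; it fails if at least one of the two inequalities is false. *)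

(* Defs.v *)
(* [A *t B] from mxtens is the Kronecker product: its (i * n + k, j * n + l)
   entry is A i j * B k l. *)
From mathcomp Require Import all_boot all_order all_algebra.
From mathcomp Require Import mxtens.
From mathcomp Require Import classical_sets reals.

Set Implicit Arguments.
Unset Strict Implicit.
Unset Printing Implicit Defensive.

Import Order.TTheory GRing.Theory Num.Theory.
Local Open Scope classical_set_scope.
Local Open Scope ring_scope.

(* X i j sits at position j * n + i: the columns of X are stacked. *)
Definition vec (R : realType) (n : nat) (X : 'M[R]_n) : 'cV[R]_(n * n) :=
  \col_p X (mxtens_unindex p).2 (mxtens_unindex p).1.

(* The 0-1 matrix with (T v)_(i * n + j) = v_(j * n + i); it is characterised
   by T (vec X) = vec X^T in [commutation_mxP]. *)
Definition commutation_mx (R : realType) (n : nat) : 'M[R]_(n * n) :=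
  \matrix_(p, q)
    (q == mxtens_index ((mxtens_unindex p).2, (mxtens_unindex p).1))%:R.

Lemma vec_surj (R : realType) (n : nat) (v : 'cV[R]_(n * n)) :
  exists X : 'M[R]_n, vec X = v.
Proof.
exists (\matrix_(i, j) v (mxtens_index (j, i)) 0).
by apply/colP => p; rewrite !mxE -surjective_pairing mxtens_unindexK.
Qed.

Lemma commutation_mx_vec (R : realType) (n : nat) (X : 'M[R]_n) :
  commutation_mx R n *m vec X = vec X^T.
Proof.
apply/colP => p; rewrite !mxE.
rewrite (bigD1 (mxtens_index ((mxtens_unindex p).2, (mxtens_unindex p).1))) //=.
rewrite big1 => [|q /negPf neq]; last by rewrite !mxE neq mul0r.
by rewrite addr0 !mxE eqxx mul1r mxtens_indexK.
Qed.

Lemma commutation_mxP (R : realType) (n : nat) (T : 'M[R]_(n * n)) :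
  (forall X : 'M[R]_n, T *m vec X = vec X^T) <-> T = commutation_mx R n.
Proof.
split=> [TE|-> X]; last exact: commutation_mx_vec.
apply/matrixP => p q; have [X XE] := vec_surj (delta_mx q 0 : 'cV[R]_(n * n)).
have: T *m vec X = commutation_mx R n *m vec X by rewrite TE commutation_mx_vec.
by rewrite XE -!colE => /colP/(_ p); rewrite !mxE.
Qed.

Lemma tensmx_vec (R : realType) (n : nat) (A B X : 'M[R]_n) :
  (A *t B) *m vec X = vec (B *m X *m A^T).
Proof.
apply/colP => p; rewrite !mxE.
under [RHS]eq_bigr => j _ do rewrite !mxE big_distrl /=.
rewrite pair_big /= (reindex (@mxtens_index n n)) /=; last first.
  by exists (@mxtens_unindex n n) => ? _; rewrite ?mxtens_indexK ?mxtens_unindexK.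
apply: eq_bigr => -[j l] _; rewrite !mxE mxtens_indexK /=.
by rewrite -mulrA mulrC.
Qed.

Definition rayleigh (R : realType) (N : nat) (M : 'M[R]_N) (u : 'cV[R]_N) : R :=
  (u^T *m M *m u) 0 0 / (u^T *m u) 0 0.

Definition sym_values (R : realType) (n : nat) (A B : 'M[R]_n) : set R :=
  [set rayleigh (A *t B) u | u in
    [set u : 'cV[R]_(n * n) | u != 0 /\ commutation_mx R n *m u = u]].

Definition skew_values (R : realType) (n : nat) (A B : 'M[R]_n) : set R :=
  [set rayleigh (A *t B) w | w in
    [set w : 'cV[R]_(n * n) | w != 0 /\ commutation_mx R n *m w = - w]].

Definition is_min (R : realType) (E : set R) (a : R) : Prop :=
  E a /\ lbound E a.

Definition is_max (R : realType) (E : set R) (a : R) : Prop :=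
  E a /\ ubound E a.

(* For n >= 2 the four extrema exist (Rayleigh quotients on the unit sphere of
   a nonzero subspace) and are unique, so the universal quantifiers only name
   them. The negation of this property includes the existence of the two
   extrema that violate an inequality. *)
Definition weak_interlacing (R : realType) (n : nat) (A B : 'M[R]_n) : Prop :=
  (forall a b, is_min (sym_values A B) a -> is_min (skew_values A B) b ->
    a <= b) /\
  (forall a b, is_max (skew_values A B) a -> is_max (sym_values A B) b ->
    a <= b).

(* Main.v *)
Require Import Defs.
From mathcomp Require Import all_boot all_order all_algebra.
From mathcomp Require Import reals.
From mathcomp Require Import mxtens ring lra.
From mathcomp Require Import boolp classical_sets topology normedtype derive.

(* At [vec X] the form of [A *t B] is [\tr (X^T *m B *m X *m A)], so the two
   sides of weak interlacing range over symmetric and skew-symmetric X.  For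
     A0 = diag(-1, 1, 3, 0),   B0 = [ -1 -2 -2  0 ]
                                    [ -2  0  0  6 ]
                                    [ -2  0 -4 -2 ]
                                    [  0  6 -2 -7 ],
   both of rank 3, the Rayleigh quotient is at most 35/6 on symmetric X by an
   explicit sum of squares, while some skew-symmetric W reaches
   258/44 = 129/22 > 35/6, so the second inequality fails.  This pair was found
   by a numerical search.  Embedding in dimension n by zeros changes neither
   bound; writing B0 = G diag(-1, 4, -4, 0) G^T with G invertible, the zeros of
   the two diagonals are then replaced by as many entries t > 0 as the ranks
   require, which moves every Rayleigh quotient by O(t). *)

Set Implicit Arguments.
Unset Strict Implicit.
Unset Printing Implicit Defensive.

Import Order.TTheory GRing.Theory Num.Theory.
Import numFieldNormedType.Exports.
Local Open Scope classical_set_scope.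
Local Open Scope ring_scope.

(** * Kronecker forms as traces, and ranks of diagonal matrices *)

Lemma vec_inj (R : realType) (n : nat) : injective (@vec R n).
Proof.
move=> X Y /colP XY; apply/matrixP => i j.
by have := XY (mxtens_index (j, i)); rewrite !mxE mxtens_indexK.
Qed.

Lemma vec_eq0 (R : realType) (n : nat) (X : 'M[R]_n) : (vec X == 0) = (X == 0).
Proof.
have <- : vec 0 = 0 :> 'cV[R]_(n * n) by apply/colP => p; rewrite !mxE.
exact: (inj_eq (@vec_inj R n)).
Qed.

Lemma mxtrace_dot (R : comNzRingType) (m n : nat) (X Y : 'M[R]_(m, n)) :
  \tr (X^T *m Y) = \sum_i \sum_j X i j * Y i j.
Proof.
rewrite exchange_big; apply: eq_bigr => j _; rewrite mxE.
by apply: eq_bigr => i _; rewrite mxE.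
Qed.

Lemma vec_dot (R : realType) (n : nat) (X Y : 'M[R]_n) :
  ((vec X)^T *m vec Y) 0 0 = \tr (X^T *m Y).
Proof.
rewrite mxtrace_dot exchange_big pair_big mxE (reindex (@mxtens_index n n)) /=.
  by apply: eq_bigr => -[i j] _; rewrite !mxE mxtens_indexK.
by exists (@mxtens_unindex n n) => ? _; rewrite ?mxtens_indexK ?mxtens_unindexK.
Qed.

Lemma dot_ge0 (R : realType) (N : nat) (u : 'cV[R]_N) : 0 <= (u^T *m u) 0 0.
Proof. by rewrite mxE sumr_ge0 // => i _; rewrite mxE -expr2 sqr_ge0. Qed.

Lemma dot_eq0 (R : realType) (N : nat) (u : 'cV[R]_N) :
  ((u^T *m u) 0 0 == 0) = (u == 0).
Proof.
apply/eqP/eqP => [|->]; last by rewrite mulmx0 mxE.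
rewrite mxE => /eqP; rewrite psumr_eq0 => [/allP u0|i _]; last first.
  by rewrite mxE -expr2 sqr_ge0.
apply/colP => i; have := u0 i (mem_index_enum i).
by rewrite !mxE -expr2 sqrf_eq0 => /eqP.
Qed.

(** Past the end of [s] the default 0 can be traded for 1: the diagonal factor becomes invertible,
    and the truncation is left to [pid_mx (size s)], which alone determines the rank. *)
Lemma rank_diag_seq (F : fieldType) (n : nat) (s : seq F) :
  (size s <= n)%N -> all (predC1 0) s ->
  \rank (diag_mx (\row_(j < n) s`_j)) = size s.
Proof.
move=> sn s0.
have -> : diag_mx (\row_(j < n) s`_j) =
    diag_mx (\row_(j < n) nth 1 s j) *m pid_mx (size s).
  rewrite mul_diag_mx; apply/matrixP => i j; rewrite !mxE -val_eqE /=.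
  case: eqP => [->|_] /=; last by rewrite mulr0.
  case: ltnP => js; first by rewrite mulr1; apply: set_nth_default.
  by rewrite nth_default // mulr0.
rewrite eqmxMfull ?rank_pid_mx // row_full_unit unitmxE det_diag unitfE.
apply/prodf_neq0 => i _; rewrite mxE.
have [js|js] := ltnP i (size s); last by rewrite nth_default ?oner_neq0.
exact: (allP s0 _ (mem_nth _ js)).
Qed.

(** With [Y = G^T *m X] the form is the trace of [Y^T *m diag_mx e *m Y *m diag_mx d]. Changing [d]
    and [e] then only changes the weights of fixed squares. *)
Lemma quadratic_diag (R : realType) (n : nat) (d e : 'rV[R]_n) (G X : 'M[R]_n) :
  ((vec X)^T *m (diag_mx d *t (G *m diag_mx e *m G^T)) *m vec X) 0 0 =
  \sum_r \sum_s d 0 s * e 0 r * (G^T *m X) r s ^+ 2.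
Proof.
rewrite -mulmxA tensmx_vec vec_dot tr_diag_mx.
have -> : X^T *m (G *m diag_mx e *m G^T *m X *m diag_mx d) =
    (G^T *m X)^T *m (diag_mx e *m (G^T *m X) *m diag_mx d).
  by rewrite trmx_mul trmxK !mulmxA.
move: (G^T *m X) => Y.
rewrite mxtrace_dot mul_mx_diag mul_diag_mx; apply: eq_bigr => r _.
apply: eq_bigr => s _; rewrite !mxE expr2 [LHS]mulrA [LHS]mulrC.
by rewrite [Y r s * (_ * _)]mulrCA !mulrA.
Qed.

(** * Attainment of the maximal Rayleigh quotient *)

Lemma continuous_mulmx_entry (R : realType) (m n : nat) (L : 'M[R]_(m, n)) i j :
  continuous (fun v : 'rV[R]_m => (v *m L) i j).
Proof.
move=> v; under eq_fun do rewrite mxE.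
apply: continuous_big => [|k _ w]; first exact: add_continuous.
apply: continuousM; first exact: coord_continuous.
exact: cst_continuous.
Qed.

Lemma continuous_quadratic (R : realType) (N : nat) (M : 'M[R]_N) :
  continuous (fun v : 'rV[R]_N => (v *m M *m v^T) 0 0).
Proof.
move=> v; under eq_fun do rewrite mxE.
apply: continuous_big => [|k _ w]; first exact: add_continuous.
apply: continuousM; first exact: continuous_mulmx_entry.
rewrite (_ : (fun v : 'rV_N => v^T k 0) = (fun v => v 0 k)).
  exact: coord_continuous.
by apply/funext => v'; rewrite mxE.
Qed.

(** The unit vectors of an eigenspace form a compact set. For [P] the commutation matrix, [c = 1]
    and [c = -1] give the symmetric and skew cases; [P = 1%:M] with [c = 1] gives the whole
    space. *)
Lemma rayleigh_max (R : realType) (N : nat) (M P : 'M[R]_N) (c : R)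
    (u0 : 'cV[R]_N) :
  u0 != 0 -> P *m u0 = c *: u0 ->
  exists a, is_max [set rayleigh M u | u in
    [set u : 'cV[R]_N | u != 0 /\ P *m u = c *: u]] a.
Proof.
move=> u0_neq0 Pu0.
(* Vectors are transposed because the extreme value theorem [EVT_max_rV] concerns row vectors. *)
pose A : set 'rV[R]_N :=
  [set v | (v *m 1%:M *m v^T) 0 0 = 1] `&`
  \bigcap_(j in setT) [set v | (v *m (P^T - c%:M)) 0 j = 0].
have Aunit (u : 'cV_N) : u != 0 -> P *m u = c *: u ->
    A ((Num.sqrt ((u^T *m u) 0 0))^-1 *: u^T).
  move=> u_neq0 Pu; have u_gt0 : 0 < (u^T *m u) 0 0.
    by rewrite lt_def dot_eq0 u_neq0 dot_ge0.
  split=> /= [|j _] /=.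
    rewrite mulmx1 linearZ /= trmxK -scalemxAl -scalemxAr scalerA mxE.
    by rewrite -expr2 exprVn sqr_sqrtr ?mulVf ?gt_eqF // ltW.
  rewrite -scalemxAl mulmxBr -trmx_mul Pu mul_mx_scalar linearZ /=.
  by rewrite subrr scaler0 mxE.
have closedA : closed A.
  apply: closedI; last apply: closed_bigI => j _.
    apply: preimage_closed (@closed_eq R 1) => v _.
    exact: continuous_quadratic.
  apply: preimage_closed (@closed_eq R 0) => v _.
  exact: continuous_mulmx_entry.
have boundedA : bounded_set A.
  exists 1; split=> // x x_gt1 v [/= v1 _].
  rewrite /Num.norm /= mx_normrE; apply/bigmax_leP; split=> [|[i j] _ /=].
    exact: ltW (lt_trans ltr01 x_gt1).
  (* The square of one coordinate is at most the sum of all squares, which is 1. *)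
  rewrite ord1 (le_trans _ (ltW x_gt1)) // -(@expr_le1 _ 2) // -normrX.
  rewrite ger0_norm ?sqr_ge0 // -v1 mulmx1 mxE (bigD1 j) //= mxE expr2 lerDl.
  by rewrite sumr_ge0 // => l _; rewrite mxE -expr2 sqr_ge0.
have cA : compact A by exact: bounded_closed_compact.
have [||v vA vmax] := EVT_max_rV (f := fun v => (v *m M *m v^T) 0 0) _ cA.
  by exists ((Num.sqrt ((u0^T *m u0) 0 0))^-1 *: u0^T); exact: Aunit.
  by apply: continuous_subspaceT => v; exact: continuous_quadratic.
move: vA; rewrite inE => -[/=]; rewrite mulmx1 => v1 Pv.
exists ((v *m M *m v^T) 0 0); split.
  exists v^T; last by rewrite /rayleigh trmxK v1 divr1.
  split.
    by apply: contra_eq_neq v1 => /(congr1 trmx); rewrite trmxK trmx0 => ->;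
       rewrite !mul0mx mxE eq_sym oner_neq0.
  apply: trmx_inj; rewrite trmx_mul trmxK linearZ /= trmxK -mul_mx_scalar.
  apply: subr0_eq; rewrite -mulmxBr; apply/rowP => j.
  by rewrite [RHS]mxE Pv.
move=> _ [u [u_neq0 Pu] <-].
have := vmax _ (mem_set (Aunit _ u_neq0 Pu)).
rewrite linearZ /= trmxK -!scalemxAl -scalemxAr scalerA mxE -expr2 exprVn.
by rewrite sqr_sqrtr ?dot_ge0 // mulrC.
Qed.

(** * Frobenius norm, a criterion for failure, and perturbation bounds *)

Definition sqnorm (R : realType) (m n : nat) (X : 'M[R]_(m, n)) : R :=
  \sum_i \sum_j X i j ^+ 2.

Lemma sqnorm_dot (R : realType) (n : nat) (X : 'M[R]_n) :
  ((vec X)^T *m vec X) 0 0 = sqnorm X.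
Proof.
rewrite vec_dot mxtrace_dot.
by under eq_bigr do under eq_bigr do rewrite -expr2.
Qed.

Lemma sqnorm_ge0 (R : realType) (m n : nat) (X : 'M[R]_(m, n)) : 0 <= sqnorm X.
Proof. by do 2!apply: sumr_ge0 => ? _; exact: sqr_ge0. Qed.

Lemma sqnorm_gt0 (R : realType) (n : nat) (X : 'M[R]_n) :
  X != 0 -> 0 < sqnorm X.
Proof. by rewrite -vec_eq0 -dot_eq0 sqnorm_dot lt_def sqnorm_ge0 andbT. Qed.

(** A violation needs both maxima to exist. [rayleigh_max] supplies them: the skew one is at least
    [beta], the symmetric one at most [alpha]. *)
Lemma not_weak_interlacing (R : realType) (n : nat) (A B W : 'M[R]_n)
    (alpha beta : R) :
  (forall X, X != 0 -> X^T = X -> rayleigh (A *t B) (vec X) <= alpha) ->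
  W != 0 -> W^T = - W -> beta <= rayleigh (A *t B) (vec W) ->
  alpha < beta -> ~ weak_interlacing A B.
Proof.
move=> symP W0 WT leW lt_ab [_ interlacing].
(* In positive dimension [1%:M] is a nonzero symmetric matrix, so the symmetric maximum is over a
   nonempty set. *)
have n_gt0 : (0 < n)%N.
  by rewrite lt0n; apply: contraNneq W0 => n0; apply/eqP/matrixP => i;
     have := ltn_ord i; rewrite [X in (_ < X)%N]n0.
have vecN : vec (- W) = - vec W by apply/colP => p; rewrite !mxE.
have [a [aP aub]] : exists a, is_max (skew_values A B) a.
  rewrite /skew_values; under eq_set do rewrite -scaleN1r.
  apply: (@rayleigh_max _ _ _ _ _ (vec W)); first by rewrite vec_eq0.
  by rewrite commutation_mx_vec WT vecN scaleN1r.
have [b bP] : exists b, is_max (sym_values A B) b.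
  rewrite /sym_values; under eq_set => u do rewrite -[X in _ = X]scale1r.
  apply: (@rayleigh_max _ _ _ _ _ (vec 1%:M)).
    rewrite vec_eq0; apply/eqP => /matrixP/(_ (Ordinal n_gt0) (Ordinal n_gt0)).
    by rewrite !mxE eqxx => /eqP; rewrite oner_eq0.
  by rewrite commutation_mx_vec trmx1 scale1r.
have := interlacing a b (conj aP aub) bP; apply/negP; rewrite -ltNge.
apply: lt_le_trans (le_trans leW _); last first.
  apply: aub; exists (vec W) => //=; split; first by rewrite vec_eq0.
  by rewrite commutation_mx_vec WT vecN.
apply: le_lt_trans lt_ab; have [[u [u0 Tu] <-] _] := bP.
have [X XE] := vec_surj u; move: u0 Tu; rewrite -XE vec_eq0 commutation_mx_vec.
by move=> X0 /vec_inj; exact: symP.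
Qed.

(** Each weight [d' * e' - d * e] splits into two terms linear in the changes, at most [K * t] each,
    and a product of changes, at most [t ^+ 2 <= t]. *)
Lemma diag_form_perturb (R : realType) (n : nat) (t K : R)
    (d d' e e' : 'rV[R]_n) (Y : 'M[R]_n) :
  t <= 1 ->
  (forall j, `|d 0 j| <= K) -> (forall j, `|e 0 j| <= K) ->
  (forall j, `|d' 0 j - d 0 j| <= t) -> (forall j, `|e' 0 j - e 0 j| <= t) ->
  `|\sum_r \sum_s d' 0 s * e' 0 r * Y r s ^+ 2
    - \sum_r \sum_s d 0 s * e 0 r * Y r s ^+ 2| <= (2 * K + 1) * t * sqnorm Y.
Proof.
move=> t1 dK eK dt et; rewrite -sumrB /sqnorm mulr_sumr.
apply: le_trans (ler_norm_sum _ _ _) _; apply: ler_sum => r _.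
rewrite -sumrB mulr_sumr.
apply: le_trans (ler_norm_sum _ _ _) _; apply: ler_sum => s _.
rewrite -mulrBl normrM (ger0_norm (sqr_ge0 _)) ler_wpM2r ?sqr_ge0 //.
have -> : d' 0 s * e' 0 r - d 0 s * e 0 r = (d' 0 s - d 0 s) * e 0 r
    + d 0 s * (e' 0 r - e 0 r) + (d' 0 s - d 0 s) * (e' 0 r - e 0 r).
  by move: (d' 0 s) (e' 0 r) (d 0 s) (e 0 r) => x y z w; ring.
have t0 : 0 <= t := le_trans (normr_ge0 _) (dt s).
apply: le_trans (ler_normD _ _) _.
rewrite [leRHS]mulrDl mul1r lerD //; last first.
  by rewrite normrM -[leRHS]mulr1 ler_pM // (le_trans (et r)).
apply: le_trans (ler_normD _ _) _; rewrite !normrM mulr_natl mulrnAl mulr2n.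
by apply: lerD; [rewrite mulrC|]; apply: ler_pM.
Qed.

(** The left side is the form of [1%:M *t (G *m G^T)] at [vec X], so its maximal Rayleigh quotient
    serves as [C]. *)
Lemma sqnorm_mul_bound (R : realType) (n : nat) (G : 'M[R]_n) :
  exists2 C, 0 <= C & forall X : 'M[R]_n, sqnorm (G^T *m X) <= C * sqnorm X.
Proof.
have formE (X : 'M[R]_n) : ((vec X)^T *m (1%:M *t (G *m G^T)) *m vec X) 0 0
    = sqnorm (G^T *m X).
  have := quadratic_diag (const_mx 1) (const_mx 1) G X.
  rewrite !diag_const_mx mulmx1 => ->; move: (G^T *m X) => Y.
  apply: eq_bigr => r _; apply: eq_bigr => s _.
  by rewrite !mxE !mul1r.
(* In dimension 0 there is no nonzero vector to maximize over, and [C = 0] works. *)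
have [[Z Z0]|all0] := pselect (exists X : 'M[R]_n, X != 0); last first.
  exists 0 => // X; have -> : X = 0.
    by apply/eqP; apply: contrapT => X0; apply: all0; exists X; apply/negP.
  rewrite mulmx0 mul0r /sqnorm big1 // => i _; rewrite big1 // => j _.
  by rewrite mxE expr0n.
have [||C [_ Cub]] := @rayleigh_max R _ (1%:M *t (G *m G^T)) 1%:M 1 (vec Z).
- by rewrite vec_eq0.
- by rewrite mul1mx scale1r.
have bound (X : 'M[R]_n) : X != 0 -> sqnorm (G^T *m X) <= C * sqnorm X.
  move=> X0; rewrite -ler_pdivrMr ?sqnorm_gt0 // -formE -(sqnorm_dot X).
  by apply: Cub; exists (vec X) => //=; rewrite vec_eq0 mul1mx scale1r.
exists C => [|X].
  have := le_trans (sqnorm_ge0 _) (bound Z Z0).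
  by rewrite pmulr_lge0 ?sqnorm_gt0.
have [->|] := eqVneq X 0; last exact: bound.
rewrite mulmx0 /sqnorm !(big1, mulr0) // => i _; rewrite big1 // => j _.
by rewrite mxE expr0n.
Qed.

(** * The pair of 4 by 4 matrices *)

Definition seqmx (R : nmodType) (m n : nat) (s : seq (seq R)) : 'M[R]_(m, n) :=
  \matrix_(i, j) (nth [::] s i)`_j.

(** The unitriangular [G] in [B0 = G diag(-1, 4, -4, 0) G^T]; omitted trailing entries default to
    0. *)
Definition factor4 (R : realType) : 'M[R]_4 :=
  seqmx 4 4 [:: [:: 1]; [:: 2; 1]; [:: 2; 1; 1]; [:: 0; 3 / 2; 2; 1]].

Definition diagA (R : realType) : seq R := [:: -1; 1; 3].
Definition diagB (R : realType) : seq R := [:: -1; 4; -4].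

(** By [quadratic_diag], the form of [A0 *t B0] at [vec X]; the fourth diagonal entries are the
    default 0. *)
Definition form4 (R : realType) (X : 'M[R]_4) : R :=
  \sum_(r < 4) \sum_(s < 4)
    (diagA R)`_s * (diagB R)`_r * ((factor4 R)^T *m X) r s ^+ 2.

Lemma form4_sym (R : realType) (X : 'M[R]_4) :
  X^T = X -> form4 X <= 35 / 6 * sqnorm X.
Proof.
move=> XT; have sym i j : X j i = X i j by rewrite -{1}XT mxE.
rewrite /form4 /sqnorm !big_ord_recl !big_ord0 /= !mxE.
rewrite !big_ord_recl !big_ord0 /= !mxE /=.
pose i1 : 'I_4 := lift ord0 ord0; pose i2 : 'I_4 := lift ord0 (lift ord0 ord0).
pose i3 : 'I_4 := lift ord0 (lift ord0 (lift ord0 ord0)).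
rewrite -/i1 -/i2 -/i3 (sym ord0 i1) (sym ord0 i2) (sym ord0 i3).
rewrite (sym i1 i2) (sym i1 i3) (sym i2 i3).
(* Symmetry leaves the ten entries on and above the diagonal as independent variables. *)
move: (X ord0 ord0) (X ord0 i1) (X ord0 i2) (X ord0 i3) => x00 x01 x02 x03.
move: (X i1 i1) (X i1 i2) (X i1 i3) (X i2 i2) (X i2 i3) (X i3 i3).
move=> x11 x12 x13 x22 x23 x33.
(* Gaussian elimination with rounded coefficients: the rounding errors are
   the cross terms absorbed in the two-variable squares at the end. *)
rewrite -subr_ge0; set p := (X in 0 <= X).
have -> : p = 4 * (x00 - x01 / 2 - x02 / 2) ^+ 2 + 5 / 6 * x00 ^+ 2
  + 35 / 2 * (x22 + x02 / 3 + x23 / 3) ^+ 2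
  + 4 * (x03 + 3 / 2 * x01 - x02 / 2) ^+ 2 + 2 / 3 * x03 ^+ 2
  + 2 * (x01 + x02 + x12 + x11) ^+ 2 + 2 / 3 * x01 ^+ 2
  + 4 * (x02 + x12 - x23 / 2 - x11 / 2) ^+ 2 + 1 / 2 * x02 ^+ 2
  + 17 / 2 * (x12 - 11 / 6 * x23 + x13 / 6) ^+ 2 + 1 / 6 * x12 ^+ 2
  + 1 / 2 * (x23 + 31 / 6 * x13 - 2 * x11) ^+ 2
  + 4 * (x13 - x11 / 6) ^+ 2 + 23 / 72 * x13 ^+ 2
  + 1 / 2 * x11 ^+ 2 + 1 / 18 * x11 ^+ 2
  + 1 / 6 * (x22 + x02) ^+ 2 + 1 / 6 * (x22 + x23) ^+ 2
  + 1 / 18 * (x02 + x23) ^+ 2 + 5 / 12 * (x12 - x23) ^+ 2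
  + 7 / 12 * (x12 + x13) ^+ 2 + 1 / 72 * (x23 + x13) ^+ 2
  + 1 / 6 * (x13 - x11) ^+ 2 + 35 / 6 * x33 ^+ 2.
  by rewrite /p; field.
by rewrite !addr_ge0 // mulr_ge0 ?sqr_ge0 //; lra.
Qed.

Definition skew4 (R : realType) : 'M[R]_4 :=
  seqmx 4 4 [:: [:: 0; -2; 2; 3]; [:: 2; 0; -2; 0]; [:: -2; 2; 0; 1];
                [:: -3; 0; -1; 0]].

Lemma tr_skew4 (R : realType) : (skew4 R)^T = - skew4 R.
Proof.
apply/matrixP => i j; rewrite !mxE.
by case: i j => [[|[|[|[|//]]]] ?] [[|[|[|[|//]]]] ?] /=; rewrite ?oppr0 ?opprK.
Qed.

Lemma sqnorm_skew4 (R : realType) : sqnorm (skew4 R) = 44.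
Proof. rewrite /sqnorm !big_ord_recl !big_ord0 !mxE /=; ring. Qed.

Lemma form4_skew4 (R : realType) : form4 (skew4 R) = 258.
Proof.
rewrite /form4 !big_ord_recl !big_ord0 /= !mxE !big_ord_recl !big_ord0 /=.
by rewrite !mxE /=; field.
Qed.

(** * Prescribed ranks in dimension [4 + p] *)

Definition padseq (R : nmodType) (s : seq R) (k : nat) (t : R) : seq R :=
  s ++ nseq (k - size s) t.

Lemma padseq_close (R : realType) (s : seq R) (k : nat) (t : R) (j : nat) :
  0 <= t -> `|(padseq s k t)`_j - s`_j| <= t.
Proof.
move=> t0; rewrite nth_cat; case: ltnP => [_|js]; first by rewrite subrr normr0.
rewrite (nth_default _ js) subr0 nth_nseq.
by case: ifP => _; rewrite ?normr0 // ger0_norm.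
Qed.

Lemma rank_padseq (F : fieldType) (n k : nat) (s : seq F) (t : F) :
  (size s <= k <= n)%N -> all (predC1 0) s -> t != 0 ->
  \rank (diag_mx (\row_(j < n) (padseq s k t)`_j)) = k.
Proof.
case/andP=> sk kn s0 t0; have size_k : size (padseq s k t) = k.
  by rewrite size_cat size_nseq subnKC.
rewrite -[RHS]size_k; apply: rank_diag_seq; first by rewrite size_k.
by rewrite all_cat s0 all_nseq /= t0 orbT.
Qed.

Lemma factor4_unit (R : realType) : factor4 R \in unitmx.
Proof.
rewrite unitmxE det_trig; last first.
  apply/is_trig_mxP => i j; rewrite !mxE.
  by case: i j => [[|[|[|[|//]]]] ?] [[|[|[|[|//]]]] ?].
by rewrite !big_ord_recl big_ord0 !mxE /= !mulr1 unitr1.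
Qed.

(** The identity block keeps the factor invertible, so [G *m D *m G^T] has the rank of [D] even when
    the padding reaches the new coordinates. *)
Definition factor (R : realType) (p : nat) : 'M[R]_(4 + p) :=
  block_mx (factor4 R) 0 0 1%:M.

Lemma factor_unit (R : realType) (p : nat) : factor R p \in unitmx.
Proof. by rewrite unitmxE det_ublock det1 mulr1 -unitmxE factor4_unit. Qed.

(** Both diagonals vanish from index 3 on, so only the leading block of the product counts, and the
    block-diagonal factor computes it from [ulsubmx X] alone. *)
Lemma form_factor (R : realType) (p : nat) (X : 'M[R]_(4 + p)) :
  \sum_r \sum_s (\row_j (diagA R)`_j : 'rV_(4 + p)) 0 s
     * (\row_j (diagB R)`_j : 'rV_(4 + p)) 0 r * ((factor R p)^T *m X) r s ^+ 2
  = form4 (ulsubmx X).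
Proof.
have zero (s : seq R) (i : 'I_p) : size s = 3 ->
    (\row_j s`_j : 'rV_(4 + p)) 0 (rshift 4 i) = 0.
  by move=> s3; rewrite mxE nth_default // s3.
rewrite big_split_ord /= [X in _ + X]big1 ?addr0 => [|r _]; last first.
  by apply: big1 => s _; rewrite [X in _ * X * _]zero // mulr0 mul0r.
apply: eq_bigr => r _.
rewrite big_split_ord /= [X in _ + X]big1 ?addr0 => [|s _]; last first.
  by rewrite zero // !mul0r.
apply: eq_bigr => s _; rewrite [(\row_j _) 0 _]mxE [(\row_j _) 0 _]mxE /=.
congr (_ * _ ^+ 2); rewrite -[X in _ *m X]submxK tr_block_mx mulmx_block.
by rewrite block_mxEul !trmx0 !mul0mx addr0.
Qed.

Lemma sqnorm_ulsub (R : realType) (p : nat) (X : 'M[R]_(4 + p)) :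
  sqnorm (ulsubmx X) <= sqnorm X.
Proof.
rewrite /sqnorm [leRHS]big_split_ord /= ler_wpDr ?sumr_ge0 // => [r _|].
  by apply: sumr_ge0 => s _; exact: sqr_ge0.
apply: ler_sum => r _; rewrite [leRHS]big_split_ord /= ler_wpDr ?sumr_ge0 //.
  by move=> s _; exact: sqr_ge0.
by apply: ler_sum => s _; rewrite !mxE.
Qed.

Lemma sqnorm_block (R : realType) (p : nat) (W : 'M[R]_4) :
  sqnorm (block_mx W 0 0 0 : 'M_(4 + p)) = sqnorm W.
Proof.
rewrite /sqnorm big_split_ord /= [X in _ + X]big1 ?addr0 => [|r _].
  apply: eq_bigr => r _.
  rewrite big_split_ord /= [X in _ + X]big1 ?addr0 => [|s _].
    by apply: eq_bigr => s _; rewrite block_mxEul.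
  by rewrite block_mxEur mxE expr0n.
rewrite big_split_ord /= !big1 ?addr0 // => s _.
  by rewrite block_mxEdr mxE expr0n.
by rewrite block_mxEdl mxE expr0n.
Qed.

Lemma not_weak_interlacing_ranks (R : realType) (m k p : nat) :
  (3 <= k <= 4 + p)%N -> (3 <= m <= 4 + p)%N ->
  exists A B : 'M[R]_(4 + p),
    [/\ A^T = A, B^T = B, \rank A = k, \rank B = m & ~ weak_interlacing A B].
Proof.
move=> hk hm; pose G := factor R p.
have [C C0 GC] := sqnorm_mul_bound G.
(* For [K = 4], which bounds both diagonals, the perturbation is at most [9 * t * C * sqnorm X]; the
   900 brings this below [1 / 100 * sqnorm X], and [C + 1] also covers [C = 0]. *)
pose t := (900 * (C + 1))^-1.
have t_gt0 : 0 < t by rewrite invr_gt0 mulr_gt0 // ltr_wpDl.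
have tC : 900 * t * C <= 1.
  rewrite mulrAC /t ler_pdivrMr; last lra.
  lra.
have t1 : t <= 1 by rewrite invf_le1; lra.
pose d (s : seq R) : 'rV[R]_(4 + p) := \row_j s`_j.
pose a := padseq (diagA R) k t; pose b := padseq (diagB R) m t.
pose A := diag_mx (d a); pose B := G *m diag_mx (d b) *m G^T.
have close X : `|((vec X)^T *m (A *t B) *m vec X) 0 0 - form4 (ulsubmx X)|
    <= 1 / 100 * sqnorm X.
  rewrite quadratic_diag -form_factor.
  apply: le_trans (@diag_form_perturb _ _ t 4 _ _ _ _ _ t1 _ _ _ _) _.
  - by case=> [[|[|[|[|j]]]] ?]; rewrite mxE /= ?nth_nil ?normrN ger0_norm; lra.
  - by case=> [[|[|[|[|j]]]] ?]; rewrite mxE /= ?nth_nil ?normrN ger0_norm; lra.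
  - by move=> j; rewrite !mxE padseq_close // ltW.
  - by move=> j; rewrite !mxE padseq_close // ltW.
  have := sqnorm_ge0 X; have := GC X; move: (sqnorm _) (sqnorm X) => y x yx x0.
  nra.
exists A, B; split.
- exact: tr_diag_mx.
- by rewrite !trmx_mul trmxK tr_diag_mx mulmxA.
- by rewrite rank_padseq //= ?oppr_eq0 ?oner_eq0 ?pnatr_eq0 ?gt_eqF.
- rewrite mxrankMfree ?row_free_unit ?unitmx_tr ?factor_unit //.
  rewrite eqmxMfull ?row_full_unit ?factor_unit //.
  by rewrite rank_padseq //= ?oppr_eq0 ?oner_eq0 ?pnatr_eq0 ?gt_eqF.
pose W : 'M[R]_(4 + p) := block_mx (skew4 R) 0 0 0.
have W44 : sqnorm W = 44 by rewrite sqnorm_block sqnorm_skew4.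
(* The gap [129 / 22 - 35 / 6 = 1 / 33] exceeds the two errors of [1 / 100] together. *)
apply: (@not_weak_interlacing R _ A B W (35 / 6 + 1 / 100)
          (129 / 22 - 1 / 100)).
- move=> X X0 XT; rewrite /rayleigh sqnorm_dot ler_pdivrMr ?sqnorm_gt0 //.
  have := close X; rewrite ler_norml => /andP[_].
  have := @form4_sym R (ulsubmx X); rewrite trmx_ulsub XT => /(_ erefl).
  (* As [35 / 6] is positive, the bound for the block extends to the larger norm of [X]. *)
  have := sqnorm_ulsub X.
  lra.
- apply/eqP => W0; have := W44; rewrite W0 /sqnorm big1 => [|i _].
    by move=> /eqP; rewrite eq_sym pnatr_eq0.
  by apply: big1 => j _; rewrite mxE expr0n.
- by rewrite tr_block_mx tr_skew4 !trmx0 opp_block_mx !oppr0.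
- have := close W; rewrite /rayleigh sqnorm_dot W44 ler_norml => /andP[+ _].
  rewrite block_mxKul form4_skew4 ler_pdivlMr //.
  lra.
lra.
Qed.

Theorem proposition12 (R : realType) (m k n : nat) (hk : (3 <= k)%N)
  (hkm : (k <= m)%N) (hn : (maxn 4 m <= n)%N) :
  exists A B : 'M[R]_n,
    [/\ A^T = A, B^T = B,
        minn (\rank A) (\rank B) = k,
        maxn (\rank A) (\rank B) = m
      & ~ weak_interlacing A B].
Proof.
move: hn; rewrite geq_max => /andP[n4 mn].
rewrite -(subnKC n4) in mn *.
have [||A [B [AT BT rA rB AB]]] := @not_weak_interlacing_ranks R m k (n - 4).
- by rewrite hk (leq_trans hkm).
- by rewrite mn (leq_trans hk).
by exists A, B; rewrite rA rB (minn_idPl hkm) (maxn_idPr hkm).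
Qed.
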